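(* Let $\varphi$ be a complete Bernstein function of the form $\varphi(x)=\int_0^\infty(1-e^{-sx})\overline\nu(s)\,ds$, with $\overline\nu$ a completely monotone Lévy density, such that $\lim_{\theta\to0}\varphi(\theta)=0$, $\lim_{\theta\to\infty}\varphi(\theta)=+\infty$, $\lim_{\theta\to0}\varphi(\theta)/\theta=+\infty$ and $\lim_{\theta\to\infty}\varphi(\theta)/\theta=0$. Let $\kappa$ be the function with Laplace transform $1/\varphi$ and $\chi(x)=\int_0^x\kappa(z)dz$. Assume that for every $\varepsilon>0$ one has $\kappa\in L^1(0,\varepsilon)\cap L^2(\varepsilon,\infty)$ and $\chi\in L^2(0,\varepsilon)$. Then the process $$B_t^\kappa=\sqrt{C_\kappa}\int_{\mathbb R}\big[\chi((t-u)_+)-\chi((-u)_+)\big]dW_u,\qquad t\ge0,$$ displays long-range dependence, i.e. $\sum_{n=1}^\infty|\rho_n|=+\infty$, where $\rho_n:=\mathbb E\big[B_1^\kappa(B_{n+1}^\kappa-B_n^\kappa)\big]$.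
   Context: A Lévy density satisfies $\int_0^\infty(s\wedge1)\overline\nu(s)ds<\infty$. $\kappa:(0,\infty)\to[0,\infty)$ is the (locally integrable, non-increasing) function with $\int_0^\infty e^{-s\theta}\kappa(s)ds=1/\varphi(\theta)$ for $\theta>0$; it exists because $\varphi$ is complete Bernstein, and is the Sonine associate of $\nu(x)=\int_x^\infty\overline\nu(z)dz$. $\chi(x)=0$ for $x\le0$, $(x)_+=\max(x,0)$. $W=(W_u)_{u\in\mathbb R}$ is a two-sided Wiener process, and $C_\kappa=\big(\int_{\mathbb R}[\chi((1-u)_+)-\chi((-u)_+)]^2du\big)^{-1}$ is a normalising constant. Under the stated hypotheses the integrand is in $L^2(\mathbb R)$ for every $t\ge0$. *)

(* Defs.v *)
From HB Require Import structures.
From mathcomp Require Import all_boot all_order all_algebra.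
From mathcomp Require Import all_classical all_reals all_analysis.

Set Implicit Arguments.
Unset Strict Implicit.
Unset Printing Implicit Defensive.

Import Order.TTheory GRing.Theory Num.Theory.
Import numFieldNormedType.Exports.

Local Open Scope classical_set_scope.
Local Open Scope ring_scope.

(** Functions on (0, +oo) are represented by total functions [R -> R] whose
    values outside (0, +oo) are irrelevant. *)

Section BernsteinFunctions.
Variable R : realType.
Implicit Types (phi nu kappa : R -> R) (D : set R).

Local Notation mu := (@lebesgue_measure R).

Definition completely_monotone nu : Prop :=
  forall (n : nat) (x : R), 0 < x ->
    derivable (nu^`(n))%classic x 1 /\ 0 <= (-1) ^+ n * (nu^`(n))%classic x.

Definition levy_density nu : Prop :=
  [/\ forall s : R, 0 < s -> 0 <= nu s,
      measurable_fun (`]0, +oo[ : set R) nu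
    & (\int[mu]_(s in `]0%R, +oo[) (Num.min s 1 * nu s)%:E < +oo)%E].

(* the Bernstein function with Levy density [nu], no killing and no drift *)
Definition levy_exponent nu (x : R) : \bar R :=
  (\int[mu]_(s in `]0%R, +oo[) ((1 - expR (- (s * x))) * nu s)%:E)%E.

Definition complete_bernstein phi : Prop :=
  exists (a b : R) nu, [/\ 0 <= a, 0 <= b, completely_monotone nu, levy_density nu
    & forall x : R, 0 < x -> (phi x)%:E = ((a + b * x)%:E + levy_exponent nu x)%E].

Definition laplace kappa (theta : R) : \bar R :=
  (\int[mu]_(s in `]0%R, +oo[) (expR (- (s * theta)) * kappa s)%:E)%E.

(* By uniqueness of Laplace transforms these conditions determine [kappa]
   almost everywhere on (0, +oo). *)
Definition inverse_laplace_kernel phi kappa : Prop :=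
  [/\ forall s : R, 0 < s -> 0 <= kappa s,
      forall r s : R, 0 < r -> r <= s -> kappa s <= kappa r,
      locally_integrable `]0, +oo[ kappa
    & forall theta : R, 0 < theta -> laplace kappa theta = ((phi theta)^-1)%:E].

Definition Lp_on (p : \bar R) D (f : R -> R) : Prop := f \_ D \in Lfun mu p.

(* For [x <= 0] the domain is empty, so [chi kappa x = 0]. *)
Definition chi kappa (x : R) : R := \int[mu]_(z in `]0, x]) kappa z.

Definition ma_kernel kappa (t u : R) : R :=
  chi kappa (Num.max (t - u) 0) - chi kappa (Num.max (- u) 0).

Definition norm_const kappa : R := (\int[mu]_u (ma_kernel kappa 1 u) ^+ 2)^-1.

End BernsteinFunctions.

Section WienerIntegral.
Context {R : realType} {d : measure_display} {T : measurableType d}.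
Variable P : probability T R.
Implicit Types (W B : R -> {RV P >-> R}) (f : R -> R) (s : seq (R * (R * R))).

Local Notation mu := (@lebesgue_measure R).

(* Taking some [A i = setT] gives the product rule for every subfamily. *)
Definition mutually_independent n (X : 'I_n -> T -> R) : Prop :=
  forall A : 'I_n -> set R, (forall i, measurable (A i)) ->
    P (\bigcap_(i in [set: 'I_n]) X i @^-1` A i) =
    (\prod_(i < n) P (X i @^-1` A i))%E.

Record two_sided_wiener W : Prop := {
  wiener0 : {ae P, forall w, W 0 w = 0} ;
  wiener_continuous : {ae P, forall w, continuous (fun u => W u w)} ;
  wiener_gaussian : forall r t, r < t ->
    forall A : set R, measurable A ->
      P ((fun w => W t w - W r w) @^-1` A) = normal_prob 0 (Num.sqrt (t - r)) A ;
  wiener_independent : forall n (t : nat -> R),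
    (forall i, (i < n)%N -> t i < t i.+1) ->
    mutually_independent (fun (i : 'I_n) w => W (t i.+1) w - W (t i) w) }.

(* The list [s] of triples [(c, (a, b))] codes the step function
   [\sum c 1_(a, b]]; triples with [b <= a] are ignored both in the function
   and in its integral. *)
Definition step_fun s (u : R) : R :=
  \sum_(p <- s | p.2.1 < p.2.2) p.1 * \1_`]p.2.1, p.2.2] u.

Definition step_int W s (w : T) : R :=
  \sum_(p <- s | p.2.1 < p.2.2) p.1 * (W p.2.2 w - W p.2.1 w).

(* [I] is a version of the Wiener integral [\int f dW]: the L^2(P)-limit of the
   integrals of some step functions converging to [f] in L^2(R).  For a
   measurable [f], such step functions exist only if [f] is in L^2(R). *)
Definition wiener_integral W f (I : {RV P >-> R}) : Prop :=
  exists s_ : nat -> seq (R * (R * R)),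
    Lnorm mu 2%:E (EFin \o (f \- step_fun (s_ n))) @[n --> \oo] --> 0%E /\
    Lnorm P 2%:E (EFin \o (I \- step_int W (s_ n))) @[n --> \oo] --> 0%E.

(* Wiener integrals are only defined up to P-null sets, hence the equality
   almost everywhere. *)
Definition B_kappa W (kappa : R -> R) B : Prop :=
  forall t : R, 0 <= t -> exists2 I : {RV P >-> R},
    wiener_integral W (ma_kernel kappa t) I &
    {ae P, forall w, B t w = Num.sqrt (norm_const kappa) * I w}.

Definition rho B (n : nat) : R :=
  fine 'E_P[fun w => B 1 w * (B n.+1%:R w - B n%:R w)].

Definition long_range_dependent B : Prop :=
  (\sum_(1 <= n <oo) `|rho B n|%:E = +oo)%E.

End WienerIntegral.

(* Main.v *)
Require Import Defs.
From HB Require Import structures.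
From mathcomp Require Import all_boot all_order all_algebra.
From mathcomp Require Import all_classical all_reals all_analysis.
From mathcomp Require Import measurable_realfun ring.
Import Order.TTheory GRing.Theory Num.Theory.
Import numFieldNormedType.Exports.
Local Open Scope classical_set_scope.
Local Open Scope ring_scope.

(** Write [f_t(u) = chi((t-u)_+) - chi((-u)_+)].  By the Wiener isometry
    [rho_n = C <f_1, f_(n+1) - f_n>], so the partial sums telescope:
    [rho_1 + ... + rho_N = C <f_1, f_(N+1) - f_1>].  The kernels are
    nonnegative and nondecreasing in [t], and for [0 < u <= 1/2] one has
    [f_1(u) >= chi(1/2) > 0] and [f_(N+1)(u) - f_1(u) >= chi(N) - chi(1)];
    hence the partial sum is at least [(C/2) chi(1/2) (chi(N) - chi(1))].
    This is unbounded, since [chi(x)] increases to the limit of the Laplace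
    transform [1/phi(theta)] as [theta] tends to 0, which is [+oo].

    The isometry only uses the variances of the increments of [W]: both the
    increments [W_b - W_a] in L^2(P) and the indicators of [(a, b]] in L^2(R)
    are increments of a curve with [||X_b - X_a||^2 = |b - a|], and by
    polarization these norms determine all inner products of increments. *)

(** * Second moment of the centred normal law *)

Section gaussian_second_moment.
Context {R : realType}.
Local Notation mu := (@lebesgue_measure R).

Lemma is_derive_gauss_fun (x : R) :
  is_derive x 1 (@gauss_fun R) (- (2 * x * gauss_fun x)).
Proof.
rewrite /gauss_fun; apply: is_derive_eq.
by rewrite /GRing.scale/= mulr1; ring.
Qed.

(** Boundary term of the integration by parts that follows, squeezed under [1/n] because
    [exp(n^2) >= 1 + n^2]. *)
Lemma cvg_natr_gauss_fun :
  n%:R * gauss_fun (n%:R : R) @[n --> \oo] --> (0 : R).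
Proof.
apply: (@squeeze_cvgr _ _ _ _ (fun=> 0) (fun n : nat => (n%:R : R)^-1)).
- near=> n; rewrite mulr_ge0 ?gauss_fun_ge0//=.
  have n0 : 0 < n%:R :> R by rewrite ltr0n; near: n; exact: nbhs_infty_gt.
  rewrite /gauss_fun expRN ler_pdivrMr ?expR_gt0// ler_pdivlMl// -expr2.
  by rewrite (le_trans _ (expR_ge1Dx _))// lerDr.
- exact: cvg_cst.
- apply/gtr0_cvgV0; last exact: cvgr_idn.
  by near=> n; rewrite ltr0n; near: n; exact: nbhs_infty_gt.
Unshelve. all: end_near. Qed.

(** Integration by parts of [x] against [2 * x * gauss_fun x], the derivative of [- gauss_fun]. *)
Lemma integral0n_sqr_gauss_fun (n : nat) : (0 < n)%N ->
  (\int[mu]_(x in `[0%R, n%:R]) (2 * (x ^+ 2 * gauss_fun x))%:E =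
   (- (n%:R * gauss_fun (n%:R : R)))%:E +
   \int[mu]_(x in `[0%R, n%:R]) (gauss_fun x)%:E)%E.
Proof.
move=> n0.
have cg := @continuous_gauss_fun R.
have dN (x : R) :
    is_derive x 1 (fun y : R => - gauss_fun y) (2 * x * gauss_fun x).
  rewrite -[X in is_derive _ _ _ X]opprK.
  exact: is_deriveN (is_derive_gauss_fun x).
have cN (x : R) : - gauss_fun y @[y --> x] --> - gauss_fun x.
  by apply: cvgN; exact: cg.
have c2 : continuous (fun x : R => 2 * x * gauss_fun x).
  move=> x; apply: cvgM; last exact: cg.
  by apply: cvgM; [exact: cvg_cst|exact: cvg_id].
rewrite [LHS](_ : _ =
    (\int[mu]_(x in `[0%R, n%:R]) (x * (2 * x * gauss_fun x))%:E)%E); last first.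
  by apply: eq_integral => x _; congr EFin; ring.
rewrite (@integration_by_parts R id (fun x => - gauss_fun x) (cst 1)
  (fun x => 2 * x * gauss_fun x) 0 n%:R).
- rewrite mul0r subr0 mulrN; congr (_ + _)%E.
  under eq_integral do rewrite /= mul1r EFinN.
  rewrite integral_ge0N ?oppeK// => x _.
  by rewrite lee_fin gauss_fun_ge0.
- by rewrite ltr0n.
- by apply: continuous_subspaceT => x; exact: cvg_cst.
- split; first by move=> x _; exact: derivable_id.
  + by apply: cvg_at_right_filter; exact: cvg_id.
  + by apply: cvg_at_left_filter; exact: cvg_id.
- by move=> x _; rewrite derive1_id.
- exact: continuous_subspaceT.
- split.
  + by move=> x _; have [] := dN x.
  + by apply: cvg_at_right_filter; exact: cN.
  + by apply: cvg_at_left_filter; exact: cN.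
- by move=> x _; rewrite derive1E derive_val.
Qed.

(** The integrand is even. On the half-line the boundary term of the integration by parts over
    [[0, n]] vanishes in the limit, leaving the Gaussian integral [sqrt pi / 2]. *)
Lemma integralT_sqr_gauss_fun :
  (\int[mu]_x (2 * (x ^+ 2 * gauss_fun x))%:E = (Num.sqrt pi)%:E)%E.
Proof.
pose f (x : R) := 2 * (x ^+ 2 * gauss_fun x).
have f0 x : 0 <= f x by rewrite /f mulr_ge0// mulr_ge0 ?gauss_fun_ge0 ?sqr_ge0.
have cf : continuous f.
  move=> x; apply: cvgM; first exact: cvg_cst.
  by apply: cvgM; [exact: exprn_continuous|exact: continuous_gauss_fun].
have mf : measurable_fun setT f by exact: continuous_measurable_fun.
rewrite (ge0_symfun_integralT f0 cf); last first.
  by move=> x; rewrite /f /gauss_fun /= sqrrN.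
rewrite (_ : [set x | _] = `[0, +oo[%classic); last first.
  by apply/seteqP; split => x/=; rewrite in_itv/= andbT.
suff -> : (\int[mu]_(x in `[0%R, +oo[) (f x)%:E =
    \int[mu]_(x in `[0%R, +oo[) (gauss_fun x)%:E)%E.
  by rewrite integral0y_gauss -EFinM mulrCA divff// mulr1.
have /cvg_lim := @ge0_cvgn_integral R mu f f0 mf.
move=> <- //.
have gc := @ge0_cvgn_integral R mu _ (@gauss_fun_ge0 R) (@measurable_gauss_fun R).
apply: cvg_lim => //.
rewrite -[X in _ --> X]add0e.
have : ((- (n%:R * gauss_fun (n%:R : R)))%:E +
    \int[mu]_(x in `[0%R, n%:R]) (gauss_fun x)%:E)%E @[n --> \oo] -->
    (0 + \int[mu]_(x in `[0%R, +oo[) (gauss_fun x)%:E)%E.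
  apply: cvgeD => //.
  apply: cvg_EFin; first exact: nearW.
  by rewrite -oppr0; apply: cvgN; exact: cvg_natr_gauss_fun.
apply: cvg_trans; apply: near_eq_cvg; near=> n.
by rewrite integral0n_sqr_gauss_fun//; near: n; exact: nbhs_infty_gt.
Unshelve. all: end_near. Qed.

Lemma integral_sqr_normal_pdf (sigma : R) : 0 < sigma ->
  (\int[mu]_x (x ^+ 2 * normal_pdf 0 sigma x)%:E = (sigma ^+ 2)%:E)%E.
Proof.
move=> s0; rewrite normal_pdfE ?gt_eqF//.
(* With this scale the substitution [y = x / a] turns the centred normal density into a multiple of
   [gauss_fun]. *)
pose a := Num.sqrt (sigma ^+ 2 *+ 2).
have a0 : 0 < a by rewrite sqrtr_gt0 pmulrn_lgt0// exprn_gt0.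
have a2 : a ^+ 2 = sigma ^+ 2 *+ 2 by rewrite sqr_sqrtr// ltW// pmulrn_lgt0// exprn_gt0.
pose F (x : R^o) := x / a.
have F'E : F^`()%classic = cst a^-1.
  by apply/funext => x; rewrite derive1Mr// derive1_id mul1r.
pose G (x : R) := 2 * (x ^+ 2 * gauss_fun x).
have cG : continuous G.
  move=> x; apply: cvgM; first exact: cvg_cst.
  by apply: cvgM; [exact: exprn_continuous|exact: continuous_gauss_fun].
have G0 x : 0 <= G x by rewrite /G mulr_ge0// mulr_ge0 ?gauss_fun_ge0 ?sqr_ge0.
have := @increasing_ge0_integration_by_substitutionT R F G.
rewrite F'E integralT_sqr_gauss_fun => /(_ _ _ _ _ _ _ _ cG G0)-H.
have {}H : ((Num.sqrt pi)%:E = \int[mu]_x (((G \o F) * cst a^-1) x)%:E)%E.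
  apply: H.
  - by move=> x y xy; rewrite /F ltr_pM2r// invr_gt0.
  - by move=> ?; exact: cvg_cst.
  - exact: is_cvg_cst.
  - exact: is_cvg_cst.
  - by [].
  - by apply: gt0_cvgMlNy; [rewrite invr_gt0|exact: cvg_id].
  - by apply: gt0_cvgMly; [rewrite invr_gt0|exact: cvg_id].
have pE x : x ^+ 2 * (normal_peak sigma * normal_fun 0 sigma x) =
    (sigma ^+ 2 / Num.sqrt pi) * ((G \o F) * cst a^-1) x.
  rewrite /normal_peak /normal_fun /G /F /gauss_fun.
  rewrite subr0 -mulrnAr mulNr -a2 -expr_div_n /=.
  have -> : Num.sqrt (sigma ^+ 2 * (pi *+ 2)) = a * Num.sqrt pi.
    rewrite /a -sqrtrM; last by rewrite ltW// pmulrn_lgt0// exprn_gt0.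
    by rewrite mulrnAr mulrnAl.
  have -> : sigma ^+ 2 = a ^+ 2 / 2 by rewrite a2 -mulr_natr mulfK.
  rewrite fctE /=.
  have alg (y b p e : R) : b != 0 -> p != 0 -> y ^+ 2 * ((b * p)^-1 * e) =
      b ^+ 2 / 2 / p * (2 * ((y / b) ^+ 2 * e) / b).
    by move=> b0 p0; field; rewrite b0 p0.
  by apply: alg; rewrite gt_eqF// sqrtr_gt0 pi_gt0.
under eq_integral do rewrite pE EFinM.
rewrite ge0_integralZl_EFin//=.
- by rewrite -H -EFinM divfK// gt_eqF// sqrtr_gt0 pi_gt0.
- by move=> x _; rewrite lee_fin mulr_ge0 ?G0//= invr_ge0 ltW.
- apply/measurable_EFinP; apply: measurable_funM => //.
  apply: measurableT_comp; first exact: continuous_measurable_fun.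
  exact: measurable_funM.
- by rewrite divr_ge0 ?sqr_ge0.
Qed.

(** The Radon-Nikodym density and [normal_pdf] have the same integral over every measurable set,
    hence agree almost everywhere. *)
Lemma ge0_integral_normal_prob (m sigma : R) (f : R -> \bar R) :
  measurable_fun setT f -> (forall x, 0 <= f x)%E ->
  (\int[normal_prob m sigma]_x f x =
   \int[mu]_x (f x * (normal_pdf m sigma x)%:E))%E.
Proof.
move=> mf f0.
have dom := @normal_prob_dominates R m sigma.
rewrite -(Radon_Nikodym_SigmaFinite.change_of_variables dom)//.
apply: ae_eq_integral => //.
- apply: emeasurable_funM => //; apply: (measurable_int mu).
  exact: Radon_Nikodym_SigmaFinite.f_integrable.
- by apply: emeasurable_funM => //; apply/measurable_EFinP; exact: measurable_normal_pdf.
- apply: ae_eqe_mul2l; apply: integral_ae_eq => //=.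
  + exact: Radon_Nikodym_SigmaFinite.f_integrable.
  + by apply/measurable_EFinP; exact: measurable_normal_pdf.
  + by move=> E _ mE; rewrite -Radon_Nikodym_SigmaFinite.f_integral.
Qed.

Lemma normal_prob_second_moment (sigma : R) : 0 < sigma ->
  (\int[normal_prob 0 sigma]_x (x ^+ 2)%:E = (sigma ^+ 2)%:E)%E.
Proof.
move=> s0; rewrite ge0_integral_normal_prob//.
- by under eq_integral do rewrite -EFinM; exact: integral_sqr_normal_pdf.
- by apply/measurable_EFinP; exact: measurable_funX.
- by move=> x; rewrite lee_fin sqr_ge0.
Qed.

End gaussian_second_moment.

(** * Inner products in L^2 and step functions *)

Section L2_inner_product.
Set Implicit Arguments.
Unset Strict Implicit.
Context {d : measure_display} {T : measurableType d} {R : realType}.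
Variable m : {measure set T -> \bar R}.
Implicit Types f g h : T -> R.

Definition dotL2 f g : R := \int[m]_x (f x * g x).

Lemma Lnorm2E f : Lnorm m 2%:E (EFin \o f) =
  ((\int[m]_x (f x ^+ 2)%:E) `^ 2^-1)%E.
Proof.
rewrite unlock; congr (_ `^ _)%E; apply: eq_integral => x _ /=.
by rewrite powR_mulrn// real_normK// num_real.
Qed.

Lemma Lfun2P f : f \in Lfun m 2%:E <->
  measurable_fun setT f /\ (\int[m]_x (f x ^+ 2)%:E < +oo)%E.
Proof.
split.
  move=> f2; split.
    by move: f2; rewrite inE => /andP[]; rewrite inE.
  have /integrableP[_] := Lfun2_integrable_sqr f2.
  by under eq_integral do rewrite gee0_abs ?lee_fin ?sqr_ge0//.
move=> [mf f2]; rewrite inE; apply/andP; split; rewrite inE//=.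
by rewrite /finite_norm Lnorm2E poweR_lty.
Qed.

Lemma Lfun2_measurable f : f \in Lfun m 2%:E -> measurable_fun setT f.
Proof. by move=> /Lfun2P[]. Qed.

Lemma Lfun2D f g : f \in Lfun m 2%:E -> g \in Lfun m 2%:E ->
  (fun x => f x + g x) \in Lfun m 2%:E.
Proof.
move=> f2 g2; have [_ /(_ 1 f g f2 g2)] := Lfun_submod_closed m (lee1n 2).
by rewrite scale1r.
Qed.

Lemma Lfun2Z (c : R) f : f \in Lfun m 2%:E -> (fun x => c * f x) \in Lfun m 2%:E.
Proof.
move=> f2; have [l0 /(_ c f 0 f2 l0)] := Lfun_submod_closed m (lee1n 2).
by rewrite addr0.
Qed.

Lemma Lfun2B f g : f \in Lfun m 2%:E -> g \in Lfun m 2%:E ->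
  (fun x => f x - g x) \in Lfun m 2%:E.
Proof.
move=> f2 g2; have := Lfun2D f2 (Lfun2Z (-1) g2).
by under eq_fun do rewrite mulN1r.
Qed.

Lemma Lfun2_sum (I : Type) (s : seq I) (Q : pred I) (F : I -> T -> R) :
  (forall i, Q i -> F i \in Lfun m 2%:E) ->
  (fun x => \sum_(i <- s | Q i) F i x) \in Lfun m 2%:E.
Proof.
move=> F2; elim: s => [|i s ih].
  under eq_fun do rewrite big_nil.
  by have [] := Lfun_submod_closed m (lee1n 2).
under eq_fun do rewrite big_cons.
by case: (boolP (Q i)) => // Qi; apply: Lfun2D => //; exact: F2.
Qed.

Lemma Lfun2M_integrable f g : f \in Lfun m 2%:E -> g \in Lfun m 2%:E ->
  m.-integrable setT (EFin \o (fun x => f x * g x)).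
Proof. by move=> f2 g2; apply/Lfun1_integrable; exact: Lfun2_mul_Lfun1. Qed.

Lemma dotL2C f g : dotL2 f g = dotL2 g f.
Proof. by apply: eq_Rintegral => x _; rewrite mulrC. Qed.

Lemma dotL2Dl f g h : f \in Lfun m 2%:E -> g \in Lfun m 2%:E ->
  h \in Lfun m 2%:E ->
  dotL2 (fun x => f x + g x) h = dotL2 f h + dotL2 g h.
Proof.
move=> f2 g2 h2; rewrite /dotL2 -RintegralD//; try exact: Lfun2M_integrable.
by apply: eq_Rintegral => x _; rewrite mulrDl.
Qed.

Lemma dotL2Zl c f h : f \in Lfun m 2%:E -> h \in Lfun m 2%:E ->
  dotL2 (fun x => c * f x) h = c * dotL2 f h.
Proof.
move=> f2 h2; rewrite /dotL2 -RintegralZl//; last exact: Lfun2M_integrable.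
by apply: eq_Rintegral => x _; rewrite mulrA.
Qed.

Lemma dotL2Bl f g h : f \in Lfun m 2%:E -> g \in Lfun m 2%:E ->
  h \in Lfun m 2%:E ->
  dotL2 (fun x => f x - g x) h = dotL2 f h - dotL2 g h.
Proof.
move=> f2 g2 h2; rewrite /dotL2 -RintegralB//; try exact: Lfun2M_integrable.
by apply: eq_Rintegral => x _; rewrite mulrBl.
Qed.

Lemma dotL2Br f g h : f \in Lfun m 2%:E -> g \in Lfun m 2%:E ->
  h \in Lfun m 2%:E ->
  dotL2 h (fun x => f x - g x) = dotL2 h f - dotL2 h g.
Proof. by move=> f2 g2 h2; rewrite dotL2C dotL2Bl// !(dotL2C h). Qed.

Lemma dotL2_suml (I : Type) (s : seq I) (Q : pred I) (F : I -> T -> R) h :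
  (forall i, Q i -> F i \in Lfun m 2%:E) -> h \in Lfun m 2%:E ->
  dotL2 (fun x => \sum_(i <- s | Q i) F i x) h =
  \sum_(i <- s | Q i) dotL2 (F i) h.
Proof.
move=> F2 h2; elim: s => [|i s ih].
  rewrite big_nil /dotL2; under eq_Rintegral do rewrite big_nil mul0r.
  by rewrite Rintegral_cst// mul0r.
rewrite big_cons; under eq_fun do rewrite big_cons.
case: (boolP (Q i)) => // Qi; rewrite dotL2Dl ?ih//; first exact: F2.
exact: Lfun2_sum.
Qed.

Lemma dotL2_polarization f g : f \in Lfun m 2%:E -> g \in Lfun m 2%:E ->
  dotL2 f g =
  (dotL2 f f + dotL2 g g - dotL2 (fun x => f x - g x) (fun x => f x - g x)) / 2.
Proof.
move=> f2 g2; rewrite dotL2Bl ?dotL2Br//; last exact: Lfun2B.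
by rewrite (dotL2C g f); field.
Qed.

Lemma integral_sqr_dotL2 f : f \in Lfun m 2%:E ->
  (\int[m]_x (f x ^+ 2)%:E = (dotL2 f f)%:E)%E.
Proof.
move=> f2; rewrite /dotL2 /Rintegral fineK; last first.
  by apply: integrable_fin_num => //; exact: Lfun2M_integrable.
by apply: eq_integral => x _; rewrite expr2.
Qed.

Lemma Lnorm2B_sym f g :
  Lnorm m 2%:E (EFin \o (f \- g)%R) = Lnorm m 2%:E (EFin \o (g \- f)%R).
Proof.
by rewrite !Lnorm2E; congr (_ `^ _)%E; apply: eq_integral => x _ /=;
  rewrite -opprB sqrrN.
Qed.

Lemma Lnorm2_triangle f g :
  measurable_fun setT f -> measurable_fun setT g ->
  (Lnorm m 2%:E (EFin \o f) <=
   Lnorm m 2%:E (EFin \o (f \- g)%R) + Lnorm m 2%:E (EFin \o g))%E.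
Proof.
move=> mf mg; have := @minkowski_EFin _ _ _ m (f \- g) g 2.
rewrite (_ : (f \- g) \+ g = f); last by apply/funext => x /=; rewrite subrK.
by apply => //; [exact: measurable_funB|rewrite ler1n].
Qed.

Lemma Lnorm2BB f g f' g' :
  measurable_fun setT f -> measurable_fun setT g ->
  measurable_fun setT f' -> measurable_fun setT g' ->
  (Lnorm m 2%:E (EFin \o ((f \- g) \- (f' \- g'))%R) <=
   Lnorm m 2%:E (EFin \o (f \- f')%R) + Lnorm m 2%:E (EFin \o (g \- g')%R))%E.
Proof.
move=> mf mg mf' mg'.
have -> : (f \- g) \- (f' \- g') = (f \- f') \+ (g' \- g).
  by apply/funext => x /=; ring.
rewrite (Lnorm2B_sym g g'); apply: minkowski_EFin; [exact: measurable_funB..|].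
by rewrite ler1n.
Qed.

End L2_inner_product.

(** * Step functions over a curve with [||X_b - X_a||^2 = |b - a|] *)

Section step_isometry.
Set Implicit Arguments.
Unset Strict Implicit.
Context {d : measure_display} {T : measurableType d} {R : realType}.
Variables (m : {measure set T -> \bar R}) (X : R -> T -> R).
Hypothesis mX : forall u, measurable_fun setT (X u).
Hypothesis intX : forall a b, a < b ->
  (\int[m]_x ((X b x - X a x) ^+ 2)%:E = (b - a)%:E)%E.

Lemma integral_sqr_increment a b :
  (\int[m]_x ((X b x - X a x) ^+ 2)%:E = `|b - a|%:E)%E.
Proof.
have [ab|ba|->] := ltgtP a b.
- by rewrite intX// gtr0_norm// subr_gt0.
- rewrite ltr0_norm ?subr_lt0// opprB -intX//.
  by apply: eq_integral => x _; rewrite -opprB sqrrN.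
- by under eq_integral do rewrite subrr expr0n/=; rewrite integral0 subrr normr0.
Qed.

Lemma increment_Lfun2 a b : (fun x => X b x - X a x) \in Lfun m 2%:E.
Proof.
apply/Lfun2P; split; first exact: measurable_funB.
by rewrite integral_sqr_increment ltry.
Qed.

Lemma dotL2_increment a b :
  dotL2 m (fun x => X b x - X a x) (fun x => X b x - X a x) = `|b - a|.
Proof.
by apply: EFin_inj; rewrite -integral_sqr_dotL2 ?integral_sqr_increment//;
  exact: increment_Lfun2.
Qed.

(** Polarization reduces each product to norms; the norms of single points cancel among the four
    terms and only distances remain. *)
Lemma dotL2_increments a b a' b' :
  dotL2 m (fun x => X b x - X a x) (fun x => X b' x - X a' x) =
  (`|b - a'| + `|a - b'| - `|b - b'| - `|a - a'|) / 2.
Proof.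
(* Only increments of [X] are known to be square integrable, so the curve is recentred at its value
   at 0 before polarizing. *)
pose Y u x := X u x - X 0 x.
have Y2 u : Y u \in Lfun m 2%:E by exact: increment_Lfun2.
have XY u v : (fun x => X u x - X v x) = (fun x => Y u x - Y v x).
  by apply/funext => x; rewrite /Y; ring.
have YX u v : dotL2 m (Y u) (Y v) =
    (dotL2 m (Y u) (Y u) + dotL2 m (Y v) (Y v) - `|u - v|) / 2.
  by rewrite dotL2_polarization// -dotL2_increment XY.
clearbody Y; rewrite !XY dotL2Bl ?dotL2Br//; last exact: Lfun2B.
rewrite (YX b b') (YX b a') (YX a b') (YX a a').
by field.
Qed.

(** Common shape of [step_fun] (half-line indicators for [X]) and [step_int] ([W] for [X]). *)
Definition step_increment (s : seq (R * (R * R))) x :=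
  \sum_(p <- s | p.2.1 < p.2.2) p.1 * (X p.2.2 x - X p.2.1 x).

(** Negating coefficients leaves the intervals untouched, so the same triples survive the filter. *)
Lemma step_increment_subE s t :
  step_increment (s ++ [seq (- p.1, p.2) | p <- t]) =
  step_increment s \- step_increment t.
Proof.
apply/funext => x /=.
rewrite /step_increment big_cat big_map/= -sumrN; congr (_ + _).
by apply: eq_bigr => p _; rewrite mulNr.
Qed.

Lemma step_increment_Lfun2 s : step_increment s \in Lfun m 2%:E.
Proof. by apply: Lfun2_sum => p _; apply: Lfun2Z; exact: increment_Lfun2. Qed.

(** The right-hand side involves neither [m] nor [X]; this is what makes the norms in L^2(P) and
    L^2(R) agree. *)
Lemma dotL2_step_increment s :
  dotL2 m (step_increment s) (step_increment s) =
  \sum_(p <- s | p.2.1 < p.2.2) \sum_(q <- s | q.2.1 < q.2.2)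
    p.1 * (q.1 * ((`|q.2.2 - p.2.1| + `|q.2.1 - p.2.2| -
                   `|q.2.2 - p.2.2| - `|q.2.1 - p.2.1|) / 2)).
Proof.
have F2 (p : R * (R * R)) : p.2.1 < p.2.2 ->
    (fun x => p.1 * (X p.2.2 x - X p.2.1 x)) \in Lfun m 2%:E.
  by move=> _; apply: Lfun2Z; exact: increment_Lfun2.
rewrite [LHS]dotL2_suml//; last exact: step_increment_Lfun2.
have D2 (p : R * (R * R)) := increment_Lfun2 p.2.1 p.2.2.
apply: eq_bigr => p pP; rewrite dotL2Zl//; last exact: step_increment_Lfun2.
rewrite dotL2C [X in _ * X]dotL2_suml// mulr_sumr.
apply: eq_bigr => q qP; congr (_ * _); rewrite dotL2Zl//.
by rewrite dotL2_increments.
Qed.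

End step_isometry.

(** * The Wiener isometry *)

Section wiener_isometry.
Set Implicit Arguments.
Unset Strict Implicit.
Context {R : realType} {d : measure_display} {T : measurableType d}.
Variables (P : probability T R) (W : R -> {RV P >-> R}).
Hypothesis W_wiener : two_sided_wiener W.
Implicit Types (f g : R -> R) (I J : T -> R) (s : seq (R * (R * R))).

Local Notation mu := (@lebesgue_measure R).

(** The law of the increment is centred normal with standard deviation [sqrt (b - a)], so the
    integral is pushed forward to a normal second moment. *)
Lemma wiener_second_moment (a b : R) : a < b ->
  (\int[P]_w ((W b w - W a w) ^+ 2)%:E = (b - a)%:E)%E.
Proof.
move=> ab; pose X (w : T) : measurableTypeR R := W b w - W a w.
have mX : measurable_fun setT X by exact: measurable_funB.
have b_a : 0 < b - a by rewrite subr_gt0.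
have := @ge0_integral_pushforward _ _ _ _ _ X mX P setT
  (fun x => (x ^+ 2)%:E) measurableT.
rewrite preimage_setT => <-.
- rewrite (@eq_measure_integral _ _ _ _ (normal_prob 0 (Num.sqrt (b - a)))).
    by rewrite normal_prob_second_moment ?sqrtr_gt0// sqr_sqrtr// ltW.
  by move=> A mA _; exact: wiener_gaussian.
- by apply/measurable_EFinP; exact: measurable_funX.
- by move=> x _; rewrite lee_fin sqr_ge0.
Qed.

(** Counterpart of [W] in L^2(R): its increments are the indicators of []a, b]]. A single half-line
    indicator is not square integrable. *)
Definition halfline_indic (u : R) : R -> R := \1_`]-oo, u].

Lemma halfline_indicB (a b : R) : a < b ->
  (fun x => halfline_indic b x - halfline_indic a x) = \1_`]a, b].
Proof.
move=> ab; apply/funext => x; rewrite /halfline_indic !indicE !mem_setE !in_itv/=.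
have [xa|ax] := leP x a; last by rewrite subr0.
by rewrite (le_trans xa (ltW ab)) subrr.
Qed.

Lemma measurable_halfline_indic u : measurable_fun setT (halfline_indic u).
Proof. exact: measurable_indic. Qed.

Lemma integral_sqr_halfline_indicB (a b : R) : a < b ->
  (\int[mu]_x ((halfline_indic b x - halfline_indic a x) ^+ 2)%:E =
   (b - a)%:E)%E.
Proof.
move=> ab.
have -> : (fun x => ((halfline_indic b x - halfline_indic a x) ^+ 2)%:E) =
    (fun x => (\1_`]a, b] x)%:E).
  apply/funext => x; have /(congr1 (fun h => h x)) -> := halfline_indicB ab.
  by rewrite indicE; case: (_ \in _); rewrite ?expr1n ?expr0n.
rewrite integral_indic//= setIT.
have := @lebesgue_measure_itv R `]a, b].
by rewrite /= lte_fin ab -EFinD.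
Qed.

Lemma step_funE s : step_fun s = step_increment halfline_indic s.
Proof.
apply/funext => x; apply: eq_bigr => p pP.
by have /(congr1 (fun h => h x)) -> := halfline_indicB pP.
Qed.

Lemma step_intE s : step_int W s = step_increment W s.
Proof. by []. Qed.

Lemma step_fun_Lfun2 s : step_fun s \in Lfun mu 2%:E.
Proof.
rewrite step_funE; apply: step_increment_Lfun2.
- exact: measurable_halfline_indic.
- exact: integral_sqr_halfline_indicB.
Qed.

Lemma step_int_Lfun2 s : step_int W s \in Lfun P 2%:E.
Proof.
rewrite step_intE; apply: step_increment_Lfun2.
- by move=> u; exact: measurable_funP.
- exact: wiener_second_moment.
Qed.

Lemma Lnorm_step_int s :
  Lnorm P 2%:E (EFin \o step_int W s) = Lnorm mu 2%:E (EFin \o step_fun s).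
Proof.
rewrite !Lnorm2E (integral_sqr_dotL2 (step_int_Lfun2 s)).
rewrite (integral_sqr_dotL2 (step_fun_Lfun2 s)) step_funE step_intE.
rewrite (@dotL2_step_increment _ _ _ mu _ measurable_halfline_indic
  integral_sqr_halfline_indicB).
by rewrite (dotL2_step_increment _ wiener_second_moment).
Qed.

(* Unlike [wiener_integral], this does not require [I] to be bundled, and it is
   stable under linear combinations. *)
Definition step_approximable f I :=
  [/\ measurable_fun setT f, measurable_fun setT I &
   forall e : R, 0 < e -> exists s,
     (Lnorm mu 2%:E (EFin \o (f \- step_fun s)%R) <= e%:E)%E /\
     (Lnorm P 2%:E (EFin \o (I \- step_int W s)%R) <= e%:E)%E].

Lemma cvge0_near_le (u : nat -> \bar R) (e : R) : 0 < e ->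
  u @ \oo --> 0%E -> \forall n \near \oo, (u n <= e%:E)%E.
Proof.
move=> e0 /fine_cvgP[ufin /cvgrPdist_le/(_ e e0)].
apply: filterS2 ufin => n un /=; rewrite sub0r normrN => /(le_trans (ler_norm _)).
by rewrite -lee_fin fineK.
Qed.

Lemma wiener_integral_approximable f (I : {RV P >-> R}) :
  measurable_fun setT f -> wiener_integral W f I -> step_approximable f I.
Proof.
move=> mf [s_ [hf hI]]; split => // e e0.
near \oo => n; exists (s_ n); split; near: n; exact: cvge0_near_le.
Unshelve. all: end_near. Qed.

(** A common approximating list [s] costs at most [e / 2] on each side, and on step functions the
    two norms coincide. *)
Lemma step_approximable_Lnorm f I : step_approximable f I ->
  Lnorm P 2%:E (EFin \o I) = Lnorm mu 2%:E (EFin \o f).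
Proof.
move=> [mf mI fI].
have tri (x y z a b : \bar R) (e : R) : (x <= a + y -> y <= b + z ->
    a <= (e / 2)%:E -> b <= (e / 2)%:E -> x <= z + e%:E)%E.
  move=> xay ybz ae be; rewrite (le_trans xay)// (splitr e) EFinD.
  by rewrite [leRHS]addeCA leeD// (le_trans ybz)// addeC leeD.
apply/eqP; rewrite eq_le; apply/andP; split; apply/lee_addgt0Pr => e e0.
- have [s [fs Is]] := fI _ (divr_gt0 e0 (ltr0Sn R 1)).
  have ms := Lfun2_measurable (step_fun_Lfun2 s).
  have mS := Lfun2_measurable (step_int_Lfun2 s).
  have := Lnorm2_triangle P mI mS; rewrite Lnorm_step_int.
  move/tri; apply; [exact: Lnorm2_triangle|exact: Is|].
  by rewrite Lnorm2B_sym.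
- have [s [fs Is]] := fI _ (divr_gt0 e0 (ltr0Sn R 1)).
  have ms := Lfun2_measurable (step_fun_Lfun2 s).
  have mS := Lfun2_measurable (step_int_Lfun2 s).
  have := Lnorm2_triangle mu mf ms; rewrite -Lnorm_step_int.
  move/tri; apply; [exact: Lnorm2_triangle|exact: fs|].
  by rewrite Lnorm2B_sym.
Qed.

(** [f] lies within distance 1 of a square integrable step function; [I] then inherits finiteness
    from the norm identity. *)
Lemma step_approximable_Lfun2 f I : step_approximable f I ->
  f \in Lfun mu 2%:E /\ I \in Lfun P 2%:E.
Proof.
move=> fI; have [mf mI /(_ 1 ltr01)[s [fs _]]] := fI.
have f2 : f \in Lfun mu 2%:E.
  rewrite inE; apply/andP; split; rewrite inE//=.
  have ms := Lfun2_measurable (step_fun_Lfun2 s).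
  rewrite /finite_norm (le_lt_trans (Lnorm2_triangle mu mf ms))// lte_add_pinfty//.
    by rewrite (le_lt_trans fs)// ltry.
  by have := step_fun_Lfun2 s; rewrite inE => /andP[_]; rewrite inE.
split => //; rewrite inE; apply/andP; split; rewrite inE//=.
rewrite /finite_norm (step_approximable_Lnorm fI).
by move: f2; rewrite inE => /andP[_]; rewrite inE.
Qed.

Lemma step_approximableB f g I J :
  step_approximable f I -> step_approximable g J ->
  step_approximable (f \- g) (I \- J).
Proof.
move=> [mf mI fI] [mg mJ gJ]; split; [exact: measurable_funB..|].
move=> e e0; have e20 : 0 < e / 2 by rewrite divr_gt0.
have [s [fs Is]] := fI _ e20; have [t [gt Jt]] := gJ _ e20.
exists (s ++ [seq (- p.1, p.2) | p <- t]).
have eE : e%:E = ((e / 2)%:E + (e / 2)%:E)%E by rewrite -EFinD -splitr.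
have mS r := Lfun2_measurable (step_fun_Lfun2 r).
have mSI r := Lfun2_measurable (step_int_Lfun2 r).
rewrite step_funE step_intE !step_increment_subE -!step_funE -!step_intE eE.
split.
- apply: le_trans (leeD fs gt).
  exact: (@Lnorm2BB _ _ _ mu f g (step_fun s) (step_fun t)).
- apply: le_trans (leeD Is Jt).
  exact: (@Lnorm2BB _ _ _ P I J (step_int W s) (step_int W t)).
Qed.

(** By polarization it suffices to have the norm identity for the pairs [(f, I)], [(g, J)] and their
    difference. *)
Lemma step_approximable_dotL2 f g I J :
  step_approximable f I -> step_approximable g J ->
  dotL2 P I J = dotL2 mu f g.
Proof.
have norm h K : step_approximable h K -> dotL2 P K K = dotL2 mu h h.
  move=> hK; have [h2 K2] := step_approximable_Lfun2 hK.
  have := step_approximable_Lnorm hK.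
  rewrite !Lnorm2E => /(congr1 (fun x => x `^ 2)%E).
  rewrite -!poweRrM mulVf// !poweRe1.
  - by rewrite (integral_sqr_dotL2 h2) (integral_sqr_dotL2 K2) => -[].
  - by apply: integral_ge0 => x _; rewrite lee_fin sqr_ge0.
  - by apply: integral_ge0 => x _; rewrite lee_fin sqr_ge0.
move=> fI gJ.
have [f2 I2] := step_approximable_Lfun2 fI.
have [g2 J2] := step_approximable_Lfun2 gJ.
rewrite (dotL2_polarization I2 J2) (dotL2_polarization f2 g2).
rewrite (norm _ _ fI) (norm _ _ gJ).
by have := norm _ _ (step_approximableB fI gJ) => ->.
Qed.

End wiener_isometry.

(** * The moving average kernel *)

Section kernel.
Set Implicit Arguments.
Unset Strict Implicit.
Context {R : realType}.
Variable kappa : R -> R.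
Local Notation mu := (@lebesgue_measure R).

Hypothesis kappa_ge0 : forall s : R, 0 < s -> 0 <= kappa s.
Hypothesis kappa_noninc : forall r s : R, 0 < r -> r <= s -> kappa s <= kappa r.
Hypothesis kappa_meas : measurable_fun (`]0, +oo[ : set R) kappa.
Hypothesis kappa_L1 : forall eps : R, 0 < eps -> Lp_on 1%E `]0, eps[ kappa.

Lemma kappa_integrable (x : R) : mu.-integrable `]0, x] (EFin \o kappa).
Proof.
(* This bound is positive and exceeds [x] whatever the sign of [x]. *)
have e0 : 0 < `|x| + 1 by rewrite ltr_wpDl.
apply: (@integrableS _ _ _ mu `]0, `|x| + 1[) => //.
  move=> y /=; rewrite !in_itv/= => /andP[-> yx] /=.
  by rewrite (le_lt_trans yx)// (le_lt_trans (ler_norm _))// ltrDl.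
apply/integrable_mkcond => //; rewrite restrict_EFin.
by apply/Lfun1_integrable; exact: kappa_L1.
Qed.

Lemma EFin_chi (x : R) :
  ((chi kappa x)%:E = \int[mu]_(z in `]0%R, x]) (kappa z)%:E)%E.
Proof.
by rewrite /chi /Rintegral fineK//; apply: integrable_fin_num => //;
  exact: kappa_integrable.
Qed.

Lemma chi_le (x y : R) : x <= y -> chi kappa x <= chi kappa y.
Proof.
move=> xy; rewrite -lee_fin !EFin_chi; apply: ge0_subset_integral => //.
- exact: measurable_int (kappa_integrable y).
- by move=> z /=; rewrite in_itv/= => /andP[z0 _]; rewrite lee_fin kappa_ge0.
- by move=> z /=; rewrite !in_itv/= => /andP[-> zx]; rewrite (le_trans zx).
Qed.

Let max_le2r (x y z : R) : x <= y -> Num.max x z <= Num.max y z.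
Proof. by move=> xy; rewrite ge_max !le_max xy lexx orbT. Qed.

Lemma ma_kernel_le (t t' u : R) : t <= t' -> ma_kernel kappa t u <= ma_kernel kappa t' u.
Proof. by move=> tt'; rewrite lerB// chi_le// max_le2r// lerB. Qed.

Lemma ma_kernel0 (u : R) : ma_kernel kappa 0 u = 0.
Proof. by rewrite /ma_kernel sub0r subrr. Qed.

Lemma ma_kernel_ge0 (t u : R) : 0 <= t -> 0 <= ma_kernel kappa t u.
Proof. by move=> t0; rewrite -(ma_kernel0 u) ma_kernel_le. Qed.

Lemma ma_kernel_chi (t u : R) : 0 <= u -> u <= t ->
  ma_kernel kappa t u = chi kappa (t - u).
Proof.
move=> u0 ut; rewrite /ma_kernel (max_idPl _) ?subr_ge0//.
rewrite (max_idPr _) ?oppr_le0// [X in _ - X]/chi set_itv_ge; last first.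
  by rewrite bnd_simp ltxx.
by rewrite Rintegral_set0 subr0.
Qed.

(** Each of the two terms is nonincreasing in [u], hence measurable. *)
Lemma measurable_ma_kernel (t : R) : measurable_fun setT (ma_kernel kappa t).
Proof.
by apply: measurable_funB; apply: nonincreasing_measurable => // u v uv;
  rewrite chi_le// max_le2r// ?lerB// lerN2.
Qed.

(** * Growth and positivity of [chi] *)

Section chi_unbounded.
Variable phi : R -> R.
Hypothesis phi_0 : phi theta @[theta --> 0^'+] --> 0.
Hypothesis phi_div_0 : phi theta / theta @[theta --> 0^'+] --> +oo.
Hypothesis kappa_laplace : forall theta : R, 0 < theta ->
  laplace kappa theta = ((phi theta)^-1)%:E.

(** As [exp (- (s * theta)) <= 1], the transform is at most the total mass of [kappa], which is the
    monotone limit of [chi kappa n]. *)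
Lemma laplace_le_bound (M theta : R) : (forall n : nat, chi kappa n%:R <= M) ->
  0 < theta -> (laplace kappa theta <= M%:E)%E.
Proof.
move=> chiM theta0.
(* The extension by zero is nonnegative on the whole line and vanishes at 0, so [[0, n]] and []0,
   n]] give the same integral. *)
pose f := kappa \_ `]0, +oo[.
have f0 x : 0 <= f x.
  by rewrite /f patchE; case: ifPn => //; rewrite inE/= in_itv/= andbT; exact: kappa_ge0.
have mf : measurable_fun setT f.
  by apply/(measurable_restrictT _ _).1 => //; exact: kappa_meas.
have cf := @ge0_cvgn_integral R mu f f0 mf.
have fM : (\int[mu]_(x in `[0%R, +oo[) (f x)%:E <= M%:E)%E.
  rewrite -(cvg_lim _ cf)//; apply: lime_le.
    by apply/cvg_ex; eexists; exact: cf.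
  apply: nearW => n; rewrite (le_trans _ (_ : (chi kappa n%:R)%:E <= _)%E)//; last first.
    by rewrite lee_fin.
  rewrite EFin_chi integral_mkcond [leRHS]integral_mkcond.
  rewrite le_eqVlt; apply/orP; left; apply/eqP; apply: eq_integral => x _.
  rewrite !patchE /f !mem_setE !in_itv/= patchE mem_setE in_itv/= andbT.
  by case: ltgtP => //=; case: ifP.
rewrite (le_trans _ fM)//.
rewrite (_ : (\int[mu]_(x in `[0%R, +oo[) (f x)%:E)%E =
    (\int[mu]_(x in `]0%R, +oo[) (kappa x)%:E)%E); last first.
  rewrite integral_mkcond [RHS]integral_mkcond; apply: eq_integral => x _.
  rewrite !patchE /f !mem_setE !in_itv/= patchE mem_setE in_itv/= !andbT.
  by case: ltgtP.
apply: ge0_le_integral => //=.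
- by move=> x; rewrite in_itv/= andbT => x0; rewrite lee_fin mulr_ge0 ?expR_ge0 ?kappa_ge0.
- apply/measurable_EFinP; apply: measurable_funM => //.
  apply: measurable_funTS; apply: measurableT_comp => //.
  by apply: measurableT_comp => //; exact: measurable_funM.
- exact/measurable_EFinP.
- move=> x; rewrite in_itv/= andbT => x0; rewrite lee_fin ler_piMl ?kappa_ge0//.
  by rewrite -expR0 ler_expR oppr_le0 mulr_ge0// ltW.
Qed.

(** A bound on [chi] would bound [1 / phi theta] for all [theta > 0], whereas [phi] tends to 0
    through positive values. *)
Lemma chi_unbounded (M : R) : exists n : nat, M < chi kappa n%:R.
Proof.
apply: contrapT => /forallNP H.
have chiM n : chi kappa n%:R <= M by rewrite leNgt; exact/negP.
pose K := `|M| + 1.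
have K0 : 0 < K by rewrite ltr_wpDl.
near (0 : R)^'+ => theta.
have theta0 : 0 < theta by [].
(* Positivity near 0 is read off from [phi theta / theta] tending to [+oo]. *)
have phi_gt0 : 0 < phi theta.
  have : 0 < phi theta / theta.
    by near: theta; move/cvgryPgt : phi_div_0; apply.
  by rewrite pmulr_lgt0// invr_gt0.
have phi_lt : phi theta < K^-1.
  by near: theta; move/cvgr_lt : phi_0; apply; rewrite invr_gt0.
have := laplace_le_bound chiM theta0; rewrite kappa_laplace// lee_fin.
apply/negP; rewrite -ltNge.
have /lt_trans : M < K by rewrite (le_lt_trans (ler_norm _))// ltrDl.
by apply; rewrite -(invrK K) ltf_pV2 ?posrE ?invr_gt0.
Unshelve. all: end_near. Qed.

(** Monotonicity gives [x * kappa x <= chi kappa x]. If the latter were at most 0, [kappa] would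
    vanish from [x] on and [chi] would stay constant there, contradicting unboundedness. *)
Lemma chi_gt0 (x : R) : 0 < x -> 0 < chi kappa x.
Proof.
move=> x0; rewrite ltNge; apply/negP => chix.
have kx : x * kappa x <= chi kappa x.
  rewrite -lee_fin EFin_chi.
  rewrite (_ : (x * kappa x)%:E = (\int[mu]_(z in `]0%R, x]) (kappa x)%:E)%E).
    apply: ge0_le_integral => //.
    - by move=> z _; rewrite lee_fin kappa_ge0.
    - exact: measurable_int (kappa_integrable x).
    - move=> z /=; rewrite in_itv/= => /andP[z0 zx].
      by rewrite lee_fin kappa_noninc.
  rewrite integral_cst//=; have := @lebesgue_measure_itv R `]0, x].
  by rewrite /= lte_fin x0 => ->; rewrite sube0 -EFinM mulrC.
have kx0 : kappa x <= 0 by rewrite -(pmulr_rle0 _ x0) (le_trans kx).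
have [n] := chi_unbounded (chi kappa x).
apply/negP; rewrite -leNgt.
have [nx|xn] := leP n%:R x; first exact: chi_le.
rewrite /chi Rintegral_mkcond [leRHS]Rintegral_mkcond.
rewrite le_eqVlt; apply/orP; left; apply/eqP; apply: eq_Rintegral => z _.
rewrite !patchE !mem_setE !in_itv/=.
have [z0|//] := ltP 0 z; have [zx|xz] := leP z x => /=.
  by rewrite (le_trans zx (ltW xn)).
case: ifP => // _; apply/eqP; rewrite eq_le kappa_ge0// andbT.
by rewrite (le_trans _ kx0)// kappa_noninc// ltW.
Qed.

End chi_unbounded.
End kernel.

(** * Lower bound for inner products and covariances of increments *)

Lemma dotL2_ge_itv (R : realType) (f g : R -> R) (h a c : R) :
  f \in Lfun (@lebesgue_measure R) 2%:E ->
  g \in Lfun (@lebesgue_measure R) 2%:E ->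
  0 < h -> 0 <= a -> 0 <= c ->
  (forall u, 0 <= f u) -> (forall u, 0 <= g u) ->
  (forall u, 0 < u -> u <= h -> a <= f u) ->
  (forall u, 0 < u -> u <= h -> c <= g u) ->
  h * (a * c) <= dotL2 (@lebesgue_measure R) f g.
Proof.
set mu := lebesgue_measure => f2 g2 h0 a0 c0 f0 g0 fa gc.
have /integrableP[mfg _] := Lfun2M_integrable f2 g2.
rewrite -lee_fin /dotL2 /Rintegral fineK; last first.
  by apply: integrable_fin_num => //; exact: Lfun2M_integrable.
have -> : ((h * (a * c))%:E = \int[mu]_(u in `]0%R, h]) (a * c)%:E)%E.
  rewrite integral_cst//=; have := @lebesgue_measure_itv R `]0, h].
  by rewrite /= lte_fin h0 => ->; rewrite sube0 -EFinM mulrC.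
apply: (@le_trans _ _ (\int[mu]_(u in `]0%R, h]) (f u * g u)%:E)%E).
  apply: ge0_le_integral => //.
  - by move=> u _; rewrite lee_fin mulr_ge0.
  - exact: measurable_funTS mfg.
  - move=> u /=; rewrite in_itv/= => /andP[u0 uh].
    by rewrite lee_fin ler_pM ?fa ?gc.
apply: ge0_subset_integral => //.
by move=> u _; rewrite lee_fin mulr_ge0.
Qed.

Section increments.
Set Implicit Arguments.
Unset Strict Implicit.
Context {R : realType} {d : measure_display} {T : measurableType d}.
Variables (P : probability T R) (W : R -> {RV P >-> R}).
Variables (kappa : R -> R) (B : R -> {RV P >-> R}).
Local Notation mu := (@lebesgue_measure R).
Local Notation f := (ma_kernel kappa).
Hypothesis W_wiener : two_sided_wiener W.
Hypothesis B_def : B_kappa W kappa B.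
Hypothesis measurable_f : forall t, measurable_fun setT (f t).

(** Square integrability comes from the existence of the Wiener integral in [B_kappa]. *)
Lemma ma_kernel_Lfun2 t : 0 <= t -> f t \in Lfun mu 2%:E.
Proof.
move=> t0; have [I fI _] := B_def t0.
by have [] := step_approximable_Lfun2 W_wiener
  (wiener_integral_approximable (measurable_f t) fI).
Qed.

Lemma norm_constE : norm_const kappa = (dotL2 mu (f 1) (f 1))^-1.
Proof. by congr (_^-1); apply: eq_Rintegral => u _; rewrite expr2. Qed.

Lemma norm_const_ge0 : 0 <= norm_const kappa.
Proof. by rewrite invr_ge0 Rintegral_ge0// => u _; rewrite sqr_ge0. Qed.

(** Isometry applied to the integrals of [f 1] and of [f n.+1 - f n]; [B] equals its integrals only
    almost everywhere, which suffices under the expectation. *)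
Lemma rhoE n : rho B n =
  norm_const kappa * dotL2 mu (f 1) (fun u => f n.+1%:R u - f n%:R u).
Proof.
have [I1 fI1 BI1] := B_def ler01.
have [In fIn BIn] := B_def (ler0n R n).
have [Im fIm BIm] := B_def (ler0n R n.+1).
have a1 := wiener_integral_approximable (measurable_f 1) fI1.
have an := wiener_integral_approximable (measurable_f _) fIn.
have am := wiener_integral_approximable (measurable_f _) fIm.
have amn := step_approximableB W_wiener am an.
have [_ I12] := step_approximable_Lfun2 W_wiener a1.
have [_ Imn2] := step_approximable_Lfun2 W_wiener amn.
rewrite -(step_approximable_dotL2 W_wiener a1 amn).
rewrite -RintegralZl//; last exact: Lfun2M_integrable.
rewrite /rho unlock; congr fine; apply: ae_eq_integral => //.
- apply/measurable_EFinP; apply: measurable_funM => //.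
  exact: measurable_funB.
- apply/measurable_EFinP; apply: measurable_funM => //.
  by apply: measurable_funM => //; exact: measurable_funB.
- move: BI1 BIn BIm; apply: filterS3 => w -> -> -> _.
  (* Each factor carries a square root of the constant; their product is the constant because it is
     nonnegative. *)
  congr EFin; rewrite /= -[in RHS](sqr_sqrtr norm_const_ge0).
  by ring.
Qed.

Lemma sum_rho N : \sum_(1 <= n < N.+1) rho B n =
  norm_const kappa * dotL2 mu (f 1) (fun u => f N.+1%:R u - f 1 u).
Proof.
have f2 n : f n%:R \in Lfun mu 2%:E by exact: ma_kernel_Lfun2.
have f12 : f 1 \in Lfun mu 2%:E by exact: (f2 1%N).
pose D n := dotL2 mu (f 1) (f n%:R).
have rE n : rho B n = norm_const kappa * (D n.+1 - D n).
  by rewrite rhoE dotL2Br.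
under eq_bigr do rewrite rE.
by rewrite -mulr_sumr telescope_sumr// dotL2Br.
Qed.

End increments.

(** * Divergence of the sum of absolute covariances *)

Theorem theorem5p3 (R : realType) (phi nu kappa : R -> R)
    (phi_cbf : complete_bernstein phi)
    (nu_cm : completely_monotone nu)
    (nu_levy : levy_density nu)
    (phi_nu : forall x : R, 0 < x -> (phi x)%:E = levy_exponent nu x)
    (phi_0 : phi theta @[theta --> 0^'+] --> 0)
    (phi_oo : phi theta @[theta --> +oo] --> +oo)
    (phi_div_0 : phi theta / theta @[theta --> 0^'+] --> +oo)
    (phi_div_oo : phi theta / theta @[theta --> +oo] --> 0)
    (kappa_phi : inverse_laplace_kernel phi kappa)
    (kappa_L1 : forall eps : R, 0 < eps -> Lp_on 1%E `]0, eps[ kappa)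
    (kappa_L2 : forall eps : R, 0 < eps -> Lp_on 2%:E `]eps, +oo[ kappa)
    (chi_L2 : forall eps : R, 0 < eps -> Lp_on 2%:E `]0, eps[ (chi kappa))
    (d : measure_display) (T : measurableType d) (P : probability T R)
    (W : R -> {RV P >-> R}) (W_wiener : two_sided_wiener W)
    (B : R -> {RV P >-> R}) (B_def : B_kappa W kappa B) :
  long_range_dependent B.
Proof.
have [kappa0 kappa_ni [kappa_m _ _] kappa_lap] := kappa_phi.
pose mu := @lebesgue_measure R.
pose f := ma_kernel kappa.
have fle := ma_kernel_le kappa0 kappa_L1.
have f_ge0 := ma_kernel_ge0 kappa0 kappa_L1.
have mf := measurable_ma_kernel kappa0 kappa_L1.
have f2 t : 0 <= t -> f t \in Lfun mu 2%:E.
  exact: (ma_kernel_Lfun2 W_wiener B_def).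
(* For [0 < u <= 1/2] also [1 - u >= 1/2], so one number serves both as the length of the interval
   and as the argument of [chi]. *)
pose h : R := 2^-1.
have h0 : 0 < h by rewrite invr_gt0.
pose a := chi kappa h.
have a0 : 0 < a.
  exact: (chi_gt0 kappa0 kappa_ni kappa_m kappa_L1 phi_0 phi_div_0 kappa_lap).
have chi_nd := chi_le kappa0 kappa_L1.
have h1 : h + h = 1 by rewrite /h [RHS]splitr div1r.
have h_le1 : h <= 1 by rewrite -h1 lerDl ltW.
have f1a u : 0 < u -> u <= h -> a <= f 1 u.
  move=> u0 uh; rewrite /f ma_kernel_chi ?(ltW u0) ?(le_trans uh)//.
  by rewrite chi_nd// lerBrDr -h1 lerD2l.
have dot_ge (g : R -> R) (c : R) : g \in Lfun mu 2%:E -> 0 <= c ->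
    (forall u, 0 <= g u) -> (forall u, 0 < u -> u <= h -> c <= g u) ->
    h * (a * c) <= dotL2 mu (f 1) g.
  move=> g2 c0 g0 gc; apply: dotL2_ge_itv => //; [exact: f2|exact: ltW|].
  by move=> u; exact: f_ge0.
(* As an inverse, the constant would be 0 if [f 1] had zero norm; [dot_ge] with [g = f 1] and
   [c = a] excludes this. *)
have C0 : 0 < norm_const kappa.
  rewrite norm_constE invr_gt0 (lt_le_trans _ (dot_ge (f 1) a _ _ _ _))//.
  - by rewrite !mulr_gt0.
  - exact: f2.
  - exact: ltW.
  - by move=> u; exact: f_ge0.
pose K := norm_const kappa * (h * a).
have K0 : 0 < K by rewrite !mulr_gt0.
have sum_ge N : (1 <= N)%N ->
    K * (chi kappa N%:R - chi kappa 1) <= \sum_(1 <= n < N.+1) `|rho B n|.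
  move=> N1.
  have chiN : chi kappa 1 <= chi kappa N%:R by rewrite chi_nd// ler1n.
  apply: (@le_trans _ _ (\sum_(1 <= n < N.+1) rho B n)); last first.
    by apply: ler_sum => n _; exact: ler_norm.
  rewrite (sum_rho W_wiener B_def mf) /K -!mulrA ler_pM2l//.
  apply: dot_ge.
  - by apply: Lfun2B; exact: f2.
  - by rewrite subr_ge0.
  - by move=> u; rewrite subr_ge0 fle// ler1n.
  (* Here the difference is [chi (N + 1 - u) - chi (1 - u)]; [u <= 1] bounds the first term below by
     [chi N], and [u >= 0] bounds the second above by [chi 1]. *)
  - move=> u u0 uh.
    have u1 : u <= 1 by exact: le_trans h_le1.
    rewrite !ma_kernel_chi ?(ltW u0)//; last by rewrite (le_trans u1)// ler1n.
    rewrite lerB// chi_nd//; last by rewrite gerBl ltW.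
    by rewrite -natr1 -addrA lerDl subr_ge0.
apply: eq_infty => M.
(* The first bound in the maximum makes the partial sum exceed [M]; the second, [chi 1 < chi N],
   rules out [N = 0]. *)
have [N] := chi_unbounded kappa0 kappa_m kappa_L1 phi_0 phi_div_0 kappa_lap
  (Num.max (M / K + chi kappa 1) (chi kappa 1)).
rewrite gt_max => /andP[MN chi1N].
have N1 : (1 <= N)%N.
  by case: N chi1N {MN} => //; rewrite ltNge chi_nd// ler01.
apply: (@le_trans _ _ (\sum_(1 <= n < N.+1) `|rho B n|%:E)%E).
  rewrite sumEFin lee_fin (le_trans _ (sum_ge _ N1))//.
  by rewrite mulrC -ler_pdivrMr// lerBrDr ltW.
exact: nneseries_lim_ge.
Qed.
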